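(* The complete ternary tree with $n$ nodes has a 1-2 drawing with height $O(n^{\log_3 ((1+\sqrt 5)/2)})\subseteq O(n^{0.439})$, with width $O(n^{\log_3 (1+\sqrt 2)})\subseteq O(n^{0.803})$, and with area $O(n^{1.242})$.
   Context: $T_h$ denotes the complete ternary tree: every non-leaf node has exactly three children and every root-to-leaf path has exactly $h$ nodes; it has $n=(3^h-1)/2$ nodes. A drawing means a planar straight-line orthogonal grid drawing: nodes at distinct integer points, each edge a horizontal or vertical segment, no crossings; width (height) is the number of vertical (horizontal) grid lines intersecting it, area is width times height. 1-2 drawings of $T_h$ are defined recursively: for $h=1$, a single node at a grid point. For $h\ge2$, take any three (not necessarily congruent) 1-2 drawings $\Gamma^a,\Gamma^b,\Gamma^c$ of $T_{h-1}$ and combine them by Construction 1 or Construction 2; the result is a 1-2 drawing of $T_h$. Construction 1: place the root $r$ of $T_h$ at a grid point; translate $\Gamma^a$ so that its topmost grid row is one unit below $r$ and its root is on the vertical line through $r$; rotate $\Gamma^b$ clockwise by $90^\circ$ and place it so its rightmost grid column is one unit left of the leftmost column of $\Gamma^a$, its root on the horizontal line through $r$; rotate $\Gamma^c$ counterclockwise by $90^\circ$ and place it so its leftmost column is one unit right of the rightmost column of $\Gamma^a$, its root on the horizontal line through $r$; connect $r$ to the three roots. Construction 2: place $r$; rotate $\Gamma^b$ clockwise by $90^\circ$ and place it so its rightmost column is one unit left of $r$, its root on the horizontal line through $r$; rotate $\Gamma^c$ counterclockwise by $90^\circ$ and place it so its leftmost column is one unit right of $r$, its root on the horizontal line through $r$;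 place $\Gamma^a$ so its topmost row is one unit below the lowest row intersecting $\Gamma^b$ or $\Gamma^c$, its root on the vertical line through $r$; connect $r$ to the three roots. *)

(* Defs.v *)
From mathcomp Require Import all_boot all_order all_algebra.
From mathcomp Require Import zify.

Set Implicit Arguments.
Unset Strict Implicit.
Unset Printing Implicit Defensive.

Import Order.TTheory GRing.Theory Num.Theory.
Local Open Scope ring_scope.

Definition ternary_size (h : nat) : nat := (3 ^ h - 1) %/ 2.

(* A grid point is (column, row); rows increase upwards. *)
Definition gridpoint : Type := int * int.

(* A rooted ternary tree with a grid point at each node; the edges are the
   straight segments between the points of a node and of its children. *)
Inductive drawing : Type :=
| Leaf of gridpoint
| Node of gridpoint & drawing & drawing & drawing.

Fixpoint complete (h : nat) (D : drawing) : bool :=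
  match D with
  | Leaf _ => h == 1%N
  | Node _ a b c =>
      [&& (1 < h)%N, complete h.-1 a, complete h.-1 b & complete h.-1 c]
  end.

Definition tree_root (D : drawing) : gridpoint :=
  match D with Leaf p => p | Node p _ _ _ => p end.

Fixpoint nodes (D : drawing) : seq gridpoint :=
  match D with
  | Leaf p => [:: p]
  | Node p a b c => p :: nodes a ++ nodes b ++ nodes c
  end.

Fixpoint edges (D : drawing) : seq (gridpoint * gridpoint) :=
  match D with
  | Leaf _ => [::]
  | Node p a b c =>
      [:: (p, tree_root a); (p, tree_root b); (p, tree_root c)] ++
      edges a ++ edges b ++ edges c
  end.

(* For an axis-parallel edge, the grid points of the segment. *)
Definition on_edge (e : gridpoint * gridpoint) (q : gridpoint) : bool :=
  [&& Num.min e.1.1 e.2.1 <= q.1 <= Num.max e.1.1 e.2.1 &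
      Num.min e.1.2 e.2.2 <= q.2 <= Num.max e.1.2 e.2.2].

Definition axis_parallel (e : gridpoint * gridpoint) : bool :=
  (e.1.1 == e.2.1) || (e.1.2 == e.2.2).

(* Two distinct axis-parallel segments with grid endpoints meet in a segment
   with grid endpoints, so grid points suffice to detect crossings. *)
Record planar_orthogonal (D : drawing) : Prop := PlanarOrthogonal {
  nodes_distinct : uniq (nodes D);
  edges_axis_parallel : all axis_parallel (edges D);
  edges_avoid_nodes : forall e q, e \in edges D -> q \in nodes D ->
    on_edge e q -> q \in [:: e.1; e.2];
  edges_noncrossing : forall e f q, e \in edges D -> f \in edges D -> e != f ->
    on_edge e q -> on_edge f q -> q \in [:: e.1; e.2] /\ q \in [:: f.1; f.2]
}.

Definition int_range (x y : int) : seq int :=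
  [seq Num.min x y + k%:Z | k <- iota 0 `|x - y|%N.+1].

(* The vertical and horizontal grid lines intersecting the drawing, without
   repetition, each given by its coordinate. *)
Definition columns (D : drawing) : seq int :=
  undup ([seq p.1 | p <- nodes D] ++
         flatten [seq int_range e.1.1 e.2.1 | e <- edges D]).

Definition rows (D : drawing) : seq int :=
  undup ([seq p.2 | p <- nodes D] ++
         flatten [seq int_range e.1.2 e.2.2 | e <- edges D]).

Definition width (D : drawing) : nat := size (columns D).
Definition height (D : drawing) : nat := size (rows D).
Definition area (D : drawing) : nat := (width D * height D)%N.

(* The default value of each extremum is the line through the root, which
   belongs to the list. *)
Definition leftmost (D : drawing) : int :=
  \big[Num.min/(tree_root D).1]_(x <- columns D) x.
Definition rightmost (D : drawing) : int :=
  \big[Num.max/(tree_root D).1]_(x <- columns D) x.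
Definition bottommost (D : drawing) : int :=
  \big[Num.min/(tree_root D).2]_(y <- rows D) y.
Definition topmost (D : drawing) : int :=
  \big[Num.max/(tree_root D).2]_(y <- rows D) y.

Fixpoint map_drawing (f : gridpoint -> gridpoint) (D : drawing) : drawing :=
  match D with
  | Leaf p => Leaf (f p)
  | Node p a b c =>
      Node (f p) (map_drawing f a) (map_drawing f b) (map_drawing f c)
  end.

Definition translate (v : gridpoint) : drawing -> drawing :=
  map_drawing (fun p => (p.1 + v.1, p.2 + v.2)).
Definition rotate_cw : drawing -> drawing := map_drawing (fun p => (p.2, - p.1)).
Definition rotate_ccw : drawing -> drawing := map_drawing (fun p => (- p.2, p.1)).

(* The placement conditions of the two constructions, for subtrees that are
   already rotated and translated: a hangs below the root r, b lies to its left
   and c to its right. *)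
Definition construction1 (r : gridpoint) (a b c : drawing) : Prop :=
  [/\ topmost a = r.2 - 1 /\ (tree_root a).1 = r.1,
      rightmost b = leftmost a - 1 /\ (tree_root b).2 = r.2
    & leftmost c = rightmost a + 1 /\ (tree_root c).2 = r.2].

Definition construction2 (r : gridpoint) (a b c : drawing) : Prop :=
  [/\ rightmost b = r.1 - 1 /\ (tree_root b).2 = r.2,
      leftmost c = r.1 + 1 /\ (tree_root c).2 = r.2
    & topmost a = Num.min (bottommost b) (bottommost c) - 1
      /\ (tree_root a).1 = r.1].

Inductive one_two_drawing : nat -> drawing -> Prop :=
| one_two_single (p : gridpoint) : one_two_drawing 1 (Leaf p)
| one_two_construction1 (h : nat) (r u v w : gridpoint) (a b c : drawing) :
    one_two_drawing h a -> one_two_drawing h b -> one_two_drawing h c ->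
    construction1 r (translate u a) (translate v (rotate_cw b))
                    (translate w (rotate_ccw c)) ->
    one_two_drawing h.+1 (Node r (translate u a) (translate v (rotate_cw b))
                                 (translate w (rotate_ccw c)))
| one_two_construction2 (h : nat) (r u v w : gridpoint) (a b c : drawing) :
    one_two_drawing h a -> one_two_drawing h b -> one_two_drawing h c ->
    construction2 r (translate u a) (translate v (rotate_cw b))
                    (translate w (rotate_ccw c)) ->
    one_two_drawing h.+1 (Node r (translate u a) (translate v (rotate_cw b))
                                 (translate w (rotate_ccw c))).

Lemma nodes_map f D : nodes (map_drawing f D) = map f (nodes D).
Proof. by elim: D => [p|p a IHa b IHb c IHc] //=; rewrite !map_cat IHa IHb IHc. Qed.

Lemma tree_root_map f D : tree_root (map_drawing f D) = f (tree_root D).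
Proof. by case: D. Qed.

Lemma edges_map f D :
  edges (map_drawing f D) = [seq (f e.1, f e.2) | e <- edges D].
Proof.
by elim: D => [p|p a IHa b IHb c IHc] //=; rewrite !map_cat !tree_root_map IHa IHb IHc.
Qed.

Lemma complete_map h f D : complete h (map_drawing f D) = complete h D.
Proof. by elim: D h => [p|p a IHa b IHb c IHc] h //=; rewrite IHa IHb IHc. Qed.

Lemma one_two_complete h D : one_two_drawing h D -> complete h D.
Proof.
have H0 h' D' : complete h' D' -> (0 < h')%N by case: D' => [p /eqP->|p a b c /andP[/ltnW]].
elim=> {h D} [p|h r u v w a b c _ Ha _ Hb _ Hc _|h r u v w a b c _ Ha _ Hb _ Hc _] //;
  by rewrite /= /translate /rotate_cw /rotate_ccw !complete_map Ha Hb Hc ltnS (H0 _ _ Ha).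
Qed.

Lemma complete_size h D : complete h D -> size (nodes D) = ternary_size h.
Proof.
rewrite /ternary_size.
suff H : complete h D -> (size (nodes D)).*2.+1 = (3 ^ h)%N.
  by move=> /H <-; rewrite subn1 /= -muln2 mulnK.
elim: D h => [p|p a IHa b IHb c IHc] h /=; first by move=> /eqP->.
case: h => [|h] // /and4P[_ /IHa Ha /IHb Hb /IHc Hc].
rewrite /= in Ha Hb Hc; rewrite !size_cat expnS; lia.
Qed.

Lemma mem_int_range x y z :
  (z \in int_range x y) = (Num.min x y <= z <= Num.max x y).
Proof.
apply/mapP/idP => [[k]|H]; first by rewrite mem_iota => Hk ->; lia.
exists `|z - Num.min x y|%N; first by rewrite mem_iota; lia.
lia.
Qed.

Definition meets (D : drawing) (q : gridpoint) : bool :=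
  (q \in nodes D) || has (fun e => on_edge e q) (edges D).

Lemma root_node D : tree_root D \in nodes D.
Proof. by case: D => *; rewrite inE eqxx. Qed.

Lemma meets_root D : meets D (tree_root D).
Proof. by rewrite /meets root_node. Qed.

Lemma meets_columns D q : meets D q -> q.1 \in columns D.
Proof.
rewrite mem_undup mem_cat => /orP[Hq|/hasP[e He Hq]]; first by rewrite map_f.
apply/orP; right; apply/flattenP; exists (int_range e.1.1 e.2.1); first exact: map_f.
by rewrite mem_int_range; case/andP: Hq.
Qed.

Lemma meets_rows D q : meets D q -> q.2 \in rows D.
Proof.
rewrite mem_undup mem_cat => /orP[Hq|/hasP[e He Hq]]; first by rewrite map_f.
apply/orP; right; apply/flattenP; exists (int_range e.1.2 e.2.2); first exact: map_f.
by rewrite mem_int_range; case/andP: Hq.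
Qed.

Lemma bigmin_mem_le (x0 y : int) s : y \in s -> \big[Num.min/x0]_(x <- s) x <= y.
Proof.
elim: s => // x s IH; rewrite inE big_cons ge_min => /orP[/eqP->|/IH->]; rewrite ?lexx ?orbT //.
Qed.

Lemma bigmax_mem_le (x0 y : int) s : y \in s -> y <= \big[Num.max/x0]_(x <- s) x.
Proof.
elim: s => // x s IH; rewrite inE big_cons le_max => /orP[/eqP->|/IH->]; rewrite ?lexx ?orbT //.
Qed.

Lemma meets_box D q : meets D q ->
  (leftmost D <= q.1 <= rightmost D) && (bottommost D <= q.2 <= topmost D).
Proof.
move=> Hq; have Hc := meets_columns Hq; have Hr := meets_rows Hq.
by rewrite !bigmin_mem_le ?bigmax_mem_le.
Qed.

Lemma meets_node D q : q \in nodes D -> meets D q.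
Proof. by rewrite /meets => ->. Qed.

Lemma meets_edge D e q : e \in edges D -> on_edge e q -> meets D q.
Proof. by move=> He Hq; apply/orP; right; apply/hasP; exists e. Qed.

Lemma meets_map (f g : gridpoint -> gridpoint) :
  cancel f g -> cancel g f ->
  (forall e q, on_edge (f e.1, f e.2) (f q) = on_edge e q) ->
  forall D q, meets (map_drawing f D) q = meets D (g q).
Proof.
move=> fK gK f_on D q.
rewrite /meets nodes_map edges_map -{1}[q]gK (mem_map (can_inj fK)) has_map.
congr (_ || _); apply: eq_has => e /=.
by rewrite -{1}[q]gK f_on.
Qed.

Lemma planar_map (f g : gridpoint -> gridpoint) :
  cancel f g -> cancel g f ->
  (forall e q, on_edge (f e.1, f e.2) (f q) = on_edge e q) ->
  (forall e, axis_parallel (f e.1, f e.2) = axis_parallel e) ->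
  forall D, planar_orthogonal D -> planar_orthogonal (map_drawing f D).
Proof.
move=> fK gK f_on f_axis D [U A N X]; split.
- by rewrite nodes_map map_inj_uniq //; apply: can_inj fK.
- by rewrite edges_map all_map; apply/allP => e /(allP A) /= He; rewrite f_axis.
- move=> e q; rewrite nodes_map edges_map => /mapP[e' He ->] /mapP[q' Hq ->].
  rewrite f_on => H; have := N _ _ He Hq H.
  by rewrite !inE !(inj_eq (can_inj fK)).
- move=> e1 e2 q; rewrite edges_map => /mapP[e He ->] /mapP[e' He' ->] Hne.
  rewrite -[q]gK !f_on => H H'.
  have Hne' : e != e' by apply: contra_neq Hne => ->.
  have := X _ _ _ He He' Hne' H H'.
  by rewrite !inE !(inj_eq (can_inj fK)).
Qed.
(* Together with planarity, the invariant carried through both constructions: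
   the vertical ray above the root avoids the drawing. *)
Definition clear_above (D : drawing) : Prop :=
  forall q, meets D q -> q.1 = (tree_root D).1 -> q.2 <= (tree_root D).2.

Lemma planar_node (r : gridpoint) (a b c : drawing) :
  planar_orthogonal a -> planar_orthogonal b -> planar_orthogonal c ->
  (tree_root a).1 = r.1 -> (tree_root b).2 = r.2 -> (tree_root c).2 = r.2 ->
  (forall q, meets a q -> q.1 = r.1 -> q.2 <= (tree_root a).2) ->
  (forall q, meets b q -> q.2 = r.2 -> q.1 <= (tree_root b).1) ->
  (forall q, meets c q -> q.2 = r.2 -> (tree_root c).1 <= q.1) ->
  (forall q, meets a q -> q.2 < r.2) ->
  (forall q, meets b q -> q.1 < r.1) ->
  (forall q, meets c q -> r.1 < q.1) ->
  (forall q, meets a q -> meets b q -> False) ->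
  (forall q, meets a q -> meets c q -> False) ->
  planar_orthogonal (Node r a b c) /\ clear_above (Node r a b c).
Proof.
move=> [Ua Aa Na Xa] [Ub Ab Nb Xb] [Uc Ac Nc Xc] ra rb rc Ra Rb Rc Ba Bb Bc Dab Dac.
have Dbc q : meets b q -> meets c q -> False by move=> /Bb + /Bc; clear; lia.
have Ma := meets_root a; have Mb := meets_root b; have Mc := meets_root c.
have ha := Ba _ Ma; have hb := Bb _ Mb; have hc := Bc _ Mc.
have Ea q : on_edge (r, tree_root a) q -> q.1 = r.1 /\ (tree_root a).2 <= q.2 <= r.2.
  by rewrite /on_edge /=; move: ra rb rc ha hb hc; clear; lia.
have Eb q : on_edge (r, tree_root b) q -> q.2 = r.2 /\ (tree_root b).1 <= q.1 <= r.1.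
  by rewrite /on_edge /=; move: ra rb rc ha hb hc; clear; lia.
have Ec q : on_edge (r, tree_root c) q -> q.2 = r.2 /\ r.1 <= q.1 <= (tree_root c).1.
  by rewrite /on_edge /=; move: ra rb rc ha hb hc; clear; lia.
pose News := [:: (r, tree_root a); (r, tree_root b); (r, tree_root c)].
have NewSub e q : e \in News -> on_edge e q ->
    [/\ meets a q -> e = (r, tree_root a) /\ q = tree_root a,
        meets b q -> e = (r, tree_root b) /\ q = tree_root b &
        meets c q -> e = (r, tree_root c) /\ q = tree_root c].
  have E (p1 p2 : gridpoint) : p1.1 = p2.1 -> p1.2 = p2.2 -> p1 = p2.
    by case: p1 p2 => [? ?] [? ?] /= -> ->.
  rewrite !inE => /or3P[]/eqP-> => [/Ea|/Eb|/Ec] [H1 H2]; split=> M.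
  - by split=> //; apply: E; [move: H1 ra; clear; lia|move: H2 (Ra _ M H1); clear; lia].
  - by exfalso; move: (Bb _ M) H1 H2; clear; lia.
  - by exfalso; move: (Bc _ M) H1 H2; clear; lia.
  - by exfalso; move: (Ba _ M) H1 H2; clear; lia.
  - by split=> //; apply: E; [move: H2 (Rb _ M H1); clear; lia|move: H1 rb; clear; lia].
  - by exfalso; move: (Bc _ M) H1 H2; clear; lia.
  - by exfalso; move: (Ba _ M) H1 H2; clear; lia.
  - by exfalso; move: (Bb _ M) H1 H2; clear; lia.
  - by split=> //; apply: E; [move: H2 (Rc _ M H1); clear; lia|move: H1 rc; clear; lia].
have Nr : [/\ ~~ meets a r, ~~ meets b r & ~~ meets c r].
  by split; apply/negP; [move=> /Ba|move=> /Bb|move=> /Bc]; clear; lia.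
case: Nr => Nra Nrb Nrc.
have Sa e q : e \in edges a -> on_edge e q -> q = tree_root a -> q \in [:: e.1; e.2].
  by move=> He Hq E; apply: Na => //; rewrite E root_node.
have Sb e q : e \in edges b -> on_edge e q -> q = tree_root b -> q \in [:: e.1; e.2].
  by move=> He Hq E; apply: Nb => //; rewrite E root_node.
have Sc e q : e \in edges c -> on_edge e q -> q = tree_root c -> q \in [:: e.1; e.2].
  by move=> He Hq E; apply: Nc => //; rewrite E root_node.
have edgesE : edges (Node r a b c) = News ++ edges a ++ edges b ++ edges c by [].
have NewEdge e f q : e \in News -> f \in edges a ++ edges b ++ edges c ->
    on_edge e q -> on_edge f q -> q \in [:: e.1; e.2] /\ q \in [:: f.1; f.2].
  move=> He; rewrite !mem_cat => /or3P[] Hf He' Hf'; have M := meets_edge Hf Hf';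
    have [Ta Tb Tc] := NewSub _ _ He He'.
  - by have [-> E] := Ta M; split; [rewrite E !inE eqxx orbT|apply: Sa E].
  - by have [-> E] := Tb M; split; [rewrite E !inE eqxx orbT|apply: Sb E].
  - by have [-> E] := Tc M; split; [rewrite E !inE eqxx orbT|apply: Sc E].
have edgesM e : (e \in edges (Node r a b c)) =
    (e \in News) || (e \in edges a ++ edges b ++ edges c).
  by rewrite edgesE mem_cat.
split; last first.
  move=> q; rewrite /meets /= => /orP[].
    rewrite inE !mem_cat => /or4P[/eqP->//|/meets_node/Ba|/meets_node/Bb|/meets_node/Bc]; clear; lia.
  rewrite !has_cat => /or4P[/Ea|/Eb|/Ec|]; try by clear; lia.
  by case/or3P => /hasP[e He /(meets_edge He)]; [move/Ba|move/Bb|move/Bc]; clear; lia.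
split.
- have disj s t : (forall q, meets s q -> meets t q -> False) ->
      ~~ has (mem (nodes s)) (nodes t).
    move=> H; apply/hasPn => q /meets_node Ht; apply/negP => /meets_node Hs.
    exact: H Hs Ht.
  rewrite /= !mem_cat !negb_or !cat_uniq has_cat negb_or Ua Ub Uc !disj //.
  by rewrite (contra (@meets_node _ _) Nra) (contra (@meets_node _ _) Nrb)
    (contra (@meets_node _ _) Nrc).
- rewrite edgesE !all_cat Aa Ab Ac /= /axis_parallel /= ra rb rc !eqxx.
  by rewrite !orbT.
- move=> e q; rewrite edgesE mem_cat /= => /orP[He|He].
    rewrite inE !mem_cat => Hn Hq; have [Ta Tb Tc] := NewSub _ _ He Hq.
    case/or4P: Hn => [/eqP->|/meets_node/Ta|/meets_node/Tb|/meets_node/Tc];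
      try by case=> -> ->; rewrite !inE eqxx orbT.
    by move: He; rewrite !inE => /or3P[]/eqP->; rewrite eqxx.
  move=> Hn Hq; move: He; rewrite !mem_cat => /or3P[] He; have M := meets_edge He Hq;
    move: Hn; rewrite inE !mem_cat => /or4P[/eqP E|Hn|Hn|Hn]; try (by move: Nra Nrb Nrc; rewrite -E M);
    first [by apply: Na|by apply: Nb|by apply: Nc|exfalso; have M' := meets_node Hn; by eauto].
- move=> e f q; rewrite !edgesM => /orP[He|He] /orP[Hf|Hf] Hne He' Hf'.
  + suff -> : q = r.
      by move: He Hf; rewrite !inE => /or3P[]/eqP-> /or3P[]/eqP->; rewrite !eqxx.
    suff : q.1 = r.1 /\ q.2 = r.2 by case: (q) (r) => ? ? [? ?] /= [-> ->].
    move: He Hf Hne He' Hf'; rewrite !inE.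
    by case/or3P => /eqP-> /or3P[]/eqP->; rewrite ?eqxx // => _;
      [move=> /Ea + /Eb|move=> /Ea + /Ec|move=> /Eb + /Ea
      |move=> /Eb + /Ec|move=> /Ec + /Ea|move=> /Ec + /Eb]; clear; lia.
  + exact: NewEdge.
  + by have [? ?] := NewEdge _ _ _ Hf He Hf' He'.
  + move: He Hf; rewrite !mem_cat => /or3P[] He /or3P[] Hf;
    first [by apply: Xa|by apply: Xb|by apply: Xc
      |exfalso; have := meets_edge He He'; have := meets_edge Hf Hf'; by eauto].
Qed.

Lemma translateK v :
  cancel (fun p : gridpoint => (p.1 + v.1, p.2 + v.2) : gridpoint)
         (fun p : gridpoint => (p.1 - v.1, p.2 - v.2)).
Proof. by case=> x y; rewrite /= !addrK. Qed.

Lemma translateVK v :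
  cancel (fun p : gridpoint => (p.1 - v.1, p.2 - v.2) : gridpoint)
         (fun p : gridpoint => (p.1 + v.1, p.2 + v.2)).
Proof. by case=> x y; rewrite /= !subrK. Qed.

Lemma rotate_cwK :
  cancel (fun p : gridpoint => (p.2, - p.1) : gridpoint)
         (fun p : gridpoint => (- p.2, p.1)).
Proof. by case=> x y; rewrite /= opprK. Qed.

Lemma rotate_ccwK :
  cancel (fun p : gridpoint => (- p.2, p.1) : gridpoint)
         (fun p : gridpoint => (p.2, - p.1)).
Proof. by case=> x y; rewrite /= opprK. Qed.

Lemma on_edge_translate (v : gridpoint) e q :
  on_edge ((e.1.1 + v.1, e.1.2 + v.2), (e.2.1 + v.1, e.2.2 + v.2))
    (q.1 + v.1, q.2 + v.2) = on_edge e q.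
Proof. by rewrite /on_edge /= !ge_min !le_max !lerD2r. Qed.

Lemma on_edge_cw e q :
  on_edge ((e.1.2, - e.1.1), (e.2.2, - e.2.1)) (q.2, - q.1) = on_edge e q.
Proof.
by rewrite /on_edge /= !ge_min !le_max !lerN2 andbC; congr andb; rewrite andbC.
Qed.

Lemma on_edge_ccw e q :
  on_edge ((- e.1.2, e.1.1), (- e.2.2, e.2.1)) (- q.2, q.1) = on_edge e q.
Proof.
by rewrite /on_edge /= !ge_min !le_max !lerN2 andbC; congr andb; rewrite andbC.
Qed.

Lemma meets_translate v D q :
  meets (translate v D) q = meets D (q.1 - v.1, q.2 - v.2).
Proof. exact: (meets_map (translateK v) (translateVK v) (on_edge_translate v)). Qed.

Lemma meets_cw D q : meets (rotate_cw D) q = meets D (- q.2, q.1).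
Proof. exact: (meets_map rotate_cwK rotate_ccwK on_edge_cw). Qed.

Lemma meets_ccw D q : meets (rotate_ccw D) q = meets D (q.2, - q.1).
Proof. exact: (meets_map rotate_ccwK rotate_cwK on_edge_ccw). Qed.

Lemma planar_translate v D : planar_orthogonal D -> planar_orthogonal (translate v D).
Proof.
apply: (planar_map (translateK v) (translateVK v) (on_edge_translate v)) => e.
by rewrite /axis_parallel /= !(inj_eq (addIr _)).
Qed.

Lemma planar_cw D : planar_orthogonal D -> planar_orthogonal (rotate_cw D).
Proof.
apply: (planar_map rotate_cwK rotate_ccwK on_edge_cw) => e.
by rewrite /axis_parallel /= eqr_opp orbC.
Qed.

Lemma planar_ccw D : planar_orthogonal D -> planar_orthogonal (rotate_ccw D).
Proof.
apply: (planar_map rotate_ccwK rotate_cwK on_edge_ccw) => e.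
by rewrite /axis_parallel /= eqr_opp orbC.
Qed.

Lemma one_two_step (r u v w : gridpoint) (a b c : drawing) :
  let a' := translate u a in
  let b' := translate v (rotate_cw b) in
  let c' := translate w (rotate_ccw c) in
  planar_orthogonal a /\ clear_above a ->
  planar_orthogonal b /\ clear_above b ->
  planar_orthogonal c /\ clear_above c ->
  construction1 r a' b' c' \/ construction2 r a' b' c' ->
  planar_orthogonal (Node r a' b' c') /\ clear_above (Node r a' b' c').
Proof.
move=> a' b' c' [Pa Ca] [Pb Cb] [Pc Cc] C.
have C' : (tree_root a').1 = r.1 /\ (tree_root b').2 = r.2 /\ (tree_root c').2 = r.2.
  by case: C => [[[_ ->] [_ ->] [_ ->]]|[[_ ->] [_ ->] [_ ->]]].
case: C' => ra [rb rc].
have Ra q : meets a' q -> q.1 = r.1 -> q.2 <= (tree_root a').2.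
  rewrite meets_translate -ra => /Ca /=; rewrite tree_root_map /=.
  by clear; lia.
have Rb q : meets b' q -> q.2 = r.2 -> q.1 <= (tree_root b').1.
  rewrite meets_translate meets_cw -rb => /Cb /=; rewrite !tree_root_map /=.
  by clear; lia.
have Rc q : meets c' q -> q.2 = r.2 -> (tree_root c').1 <= q.1.
  rewrite meets_translate meets_ccw -rc => /Cc /=; rewrite !tree_root_map /=.
  by clear; lia.
have {Pa Ca}Pa : planar_orthogonal a' by apply: planar_translate.
have {Pb Cb}Pb : planar_orthogonal b' by apply/planar_translate/planar_cw.
have {Pc Cc}Pc : planar_orthogonal c' by apply/planar_translate/planar_ccw.
have Ma := meets_box (meets_root a').
have Mb := meets_box (meets_root b').
have Mc := meets_box (meets_root c').
clearbody a' b' c'.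
have Box D q : meets D q -> [/\ leftmost D <= q.1, q.1 <= rightmost D,
    bottommost D <= q.2 & q.2 <= topmost D].
  by move/meets_box => /andP[/andP[? ?] /andP[? ?]].
apply: planar_node => //.
- by move=> q /Box [_ _ _ H]; case: C => [[[h _] _ _]|[_ _ [h _]]];
    move: h H Mb rb; clear; lia.
- by move=> q /Box [_ H _ _]; case: C => [[_ [h _] _]|[[h _] _ _]];
    move: h H Ma ra; clear; lia.
- by move=> q /Box [H _ _ _]; case: C => [[_ _ [h _]]|[_ [h _] _]];
    move: h H Ma ra; clear; lia.
- move=> q /Box [H1 H2 H3 H4] /Box [K1 K2 K3 K4].
  by case: C => [[_ [h _] _]|[_ _ [h _]]]; move: h H1 H4 K2 K3; clear; lia.
- move=> q /Box [H1 H2 H3 H4] /Box [K1 K2 K3 K4].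
  by case: C => [[_ _ [h _]]|[_ _ [h _]]]; move: h H2 H4 K1 K3; clear; lia.
Qed.

Lemma one_two_clear h D :
  one_two_drawing h D -> planar_orthogonal D /\ clear_above D.
Proof.
elim=> {h D} [p|h r u v w a b c _ Ha _ Hb _ Hc C|h r u v w a b c _ Ha _ Hb _ Hc C].
- split; first by split.
  by move=> q; rewrite /meets inE orbF => /eqP->.
- by apply: one_two_step => //; left.
- by apply: one_two_step => //; right.
Qed.

Lemma one_two_planar h D : one_two_drawing h D -> planar_orthogonal D.
Proof. by case/one_two_clear. Qed.

(* Main.v *)
Require Import Defs.
From mathcomp Require Import all_boot all_order all_algebra.
From mathcomp Require Import all_classical all_reals all_analysis.
From mathcomp Require Import zify ring lra.
Import Order.TTheory GRing.Theory Num.Theory.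
Import numFieldNormedType.Exports.
Local Open Scope ring_scope.
Local Open Scope classical_set_scope.

Set Implicit Arguments.
Unset Strict Implicit.
Unset Printing Implicit Defensive.

(** Two families of 1-2 drawings are built together, symmetric about the root
    column up to bounds: flat ones [X_h] (height [m], half-width [x]) and narrow
    ones [Y_h] (half-width [y], height [k]).  [X_(h+1)] combines [X_h, Y_h, Y_h]
    by Construction 1 and [Y_(h+1)] combines [Y_h, X_h, X_h] by Construction 2.
    The short sides satisfy [m' = y + m + 1] and [y' = m], a Fibonacci
    recurrence, whence growth [((1 + sqrt 5) / 2)^h].  The long sides
    [w = 2 x + 1] and [k] satisfy [w' = w + 2 k] and [k' = w + k], whence growth
    [(1 + sqrt 2)^h].  The flat drawings realise all three bounds. *)

(** * Extreme lines and line counts in terms of nodes *)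

(* [columns D], [leftmost D], [rightmost D] are convertible to [lines fst D],
   [lowest fst D], [highest fst D], and likewise the rows with [snd]. *)
Definition lines (pi : gridpoint -> int) (D : drawing) : seq int :=
  undup ([seq pi p | p <- nodes D] ++
         flatten [seq int_range (pi e.1) (pi e.2) | e <- edges D]).

Definition lowest pi D := \big[Num.min/pi (tree_root D)]_(x <- lines pi D) x.
Definition highest pi D := \big[Num.max/pi (tree_root D)]_(x <- lines pi D) x.

Lemma edges_nodes e D : e \in edges D -> (e.1 \in nodes D) && (e.2 \in nodes D).
Proof.
elim: D => [//|p a IHa b IHb c IHc] /=.
rewrite !inE !mem_cat => /or4P[/eqP->|/eqP->|/eqP->|/or3P[/IHa|/IHb|/IHc]] /=;
  rewrite ?root_node ?eqxx ?orbT // => /andP[-> ->]; by rewrite ?orbT.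
Qed.

Lemma node_lines pi D p : p \in nodes D -> pi p \in lines pi D.
Proof. by move=> Dp; rewrite mem_undup mem_cat map_f. Qed.

(** A line that meets an edge lies between the lines of its endpoints, which are nodes. Extrema and
    line counts thereby reduce to bounds on nodes alone. *)
Lemma linesP pi D (x : int) : x \in lines pi D ->
  exists p q : gridpoint, [/\ p \in nodes D, q \in nodes D & pi p <= x <= pi q].
Proof.
rewrite mem_undup mem_cat => /orP[/mapP[p Dp ->]|].
  by exists p, p; rewrite lexx.
move=> /flattenP[s /mapP[[p q] De ->]] /=.
rewrite mem_int_range; have /andP[Dp Dq] := edges_nodes De => xpq.
have [h|h] := leP (pi p) (pi q); first by exists p, q; split=> //; lia.
by exists q, p; split=> //; lia.
Qed.

Lemma lowest_le pi D (p : gridpoint) : p \in nodes D -> lowest pi D <= pi p.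
Proof. by move=> Dp; apply/bigmin_mem_le/node_lines. Qed.

Lemma highest_ge pi D (p : gridpoint) : p \in nodes D -> pi p <= highest pi D.
Proof. by move=> Dp; apply/bigmax_mem_le/node_lines. Qed.

Lemma lowest_ge pi D (m : int) : (forall p : gridpoint, p \in nodes D -> m <= pi p) -> m <= lowest pi D.
Proof.
move=> Dm; rewrite /lowest big_seq.
elim/big_rec: _ => [|x y /linesP[p [_ [/Dm mp _ /andP[px _]]]] my].
  exact/Dm/root_node.
by rewrite le_min my (le_trans mp).
Qed.

Lemma highest_le pi D (m : int) : (forall p : gridpoint, p \in nodes D -> pi p <= m) -> highest pi D <= m.
Proof.
move=> Dm; rewrite /highest big_seq.
elim/big_rec: _ => [|x y /linesP[_ [q [_ /Dm qm /andP[_ xq]]]] my].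
  exact/Dm/root_node.
by rewrite ge_max my (le_trans xq).
Qed.

Lemma lowest_map pi f k D : (forall p : gridpoint, pi (f p) = pi p + k) ->
  lowest pi (map_drawing f D) = lowest pi D + k.
Proof.
move=> pif; apply/le_anti/andP; split; last first.
  by apply: lowest_ge => p; rewrite nodes_map => /mapP[q Dq ->];
    rewrite pif lerD2r lowest_le.
rewrite -lerBlDr; apply: lowest_ge => p Dp.
by rewrite lerBlDr -pif lowest_le // nodes_map map_f.
Qed.

Lemma highest_map pi f k D : (forall p : gridpoint, pi (f p) = pi p + k) ->
  highest pi (map_drawing f D) = highest pi D + k.
Proof.
move=> pif; apply/le_anti/andP; split.
  by apply: highest_le => p; rewrite nodes_map => /mapP[q Dq ->];
    rewrite pif lerD2r highest_ge.
rewrite -lerBrDr; apply: highest_le => p Dp.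
by rewrite lerBrDr -pif highest_ge // nodes_map map_f.
Qed.

Lemma size_lines pi D (m : nat) :
  (forall p q : gridpoint, p \in nodes D -> q \in nodes D -> pi p - pi q < m%:Z) ->
  (size (lines pi D) <= m)%N.
Proof.
move=> Dm.
have span : highest pi D - lowest pi D < m%:Z.
  suff : highest pi D - m%:Z + 1 <= lowest pi D by clear; lia.
  apply: lowest_ge => q Dq.
  suff : highest pi D <= pi q + m%:Z - 1 by clear; lia.
  by apply: highest_le => p Dp; move: (Dm _ _ Dp Dq); clear; lia.
pose s := [seq lowest pi D + k%:Z | k <- iota 0 m].
have -> : m = size s by rewrite size_map size_iota.
apply: uniq_leq_size; first exact: undup_uniq.
move=> x /linesP[p [q [Dp Dq pxq]]].
have := lowest_le pi Dp; have := highest_ge pi Dq => hq lp.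
by apply/mapP; exists `|x - lowest pi D|%N; rewrite ?mem_iota; lia.
Qed.

(** * Extents relative to the root *)

(** Columns are measured from the root because subtrees are aligned along their root lines. Rows
    only need a total count, since in that direction a subtree is placed by its extreme line. *)
Definition fits (D : drawing) (l m : nat) : Prop :=
  (forall p : gridpoint, p \in nodes D ->
    (tree_root D).1 - l%:Z <= p.1 <= (tree_root D).1 + l%:Z) /\
  (forall p q : gridpoint, p \in nodes D -> q \in nodes D -> p.2 - q.2 < m%:Z).

(** The bound about the root is symmetric, so one predicate serves both quarter turns. *)
Definition fits_rotated (D : drawing) (l m : nat) : Prop :=
  (forall p : gridpoint, p \in nodes D ->
    (tree_root D).2 - l%:Z <= p.2 <= (tree_root D).2 + l%:Z) /\
  (forall p q : gridpoint, p \in nodes D -> q \in nodes D -> p.1 - q.1 < m%:Z).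

Lemma fits_translate u D l m : fits D l m -> fits (translate u D) l m.
Proof.
case=> wD hD; split=> [p|p q]; rewrite nodes_map => /mapP[p' Dp ->].
  by move: (wD _ Dp); rewrite tree_root_map /=; clear; lia.
by move=> /mapP[q' Dq ->]; move: (hD _ _ Dp Dq) => /=; clear; lia.
Qed.

Lemma fits_rotate_cw u D l m :
  fits D l m -> fits_rotated (translate u (rotate_cw D)) l m.
Proof.
case=> wD hD; split=> [p|p q]; rewrite !nodes_map -map_comp => /mapP[p' Dp ->].
  by move: (wD _ Dp); rewrite !tree_root_map /=; clear; lia.
by move=> /mapP[q' Dq ->]; move: (hD _ _ Dp Dq) => /=; clear; lia.
Qed.

Lemma fits_rotate_ccw u D l m :
  fits D l m -> fits_rotated (translate u (rotate_ccw D)) l m.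
Proof.
case=> wD hD; split=> [p|p q]; rewrite !nodes_map -map_comp => /mapP[p' Dp ->].
  by move: (wD _ Dp); rewrite !tree_root_map /=; clear; lia.
by move=> /mapP[q' Dq ->]; move: (hD _ _ Dq Dp) => /=; clear; lia.
Qed.

Lemma fits_width D l m : fits D l m -> (width D <= l.*2.+1)%N.
Proof.
by case=> wD _; apply: (@size_lines fst) => p q /wD + /wD; clear; lia.
Qed.

Lemma fits_height D l m : fits D l m -> (height D <= m)%N.
Proof. by case=> _; apply: (@size_lines snd). Qed.

Lemma fits_topmost D l m (p : gridpoint) : fits D l m -> p \in nodes D ->
  topmost D - m%:Z < p.2 <= topmost D.
Proof.
move=> [_ hD] Dp; rewrite (@highest_ge snd) // andbT.
suff : topmost D <= p.2 + m%:Z - 1 by clear; lia.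
by apply: (@highest_le snd) => q Dq; move: (hD _ _ Dq Dp); clear; lia.
Qed.

Lemma fits_rightmost D l m (p : gridpoint) : fits_rotated D l m -> p \in nodes D ->
  rightmost D - m%:Z < p.1 <= rightmost D.
Proof.
move=> [_ hD] Dp; rewrite (@highest_ge fst) // andbT.
suff : rightmost D <= p.1 + m%:Z - 1 by clear; lia.
by apply: (@highest_le fst) => q Dq; move: (hD _ _ Dq Dp); clear; lia.
Qed.

Lemma fits_leftmost D l m (p : gridpoint) : fits_rotated D l m -> p \in nodes D ->
  leftmost D <= p.1 < leftmost D + m%:Z.
Proof.
move=> [_ hD] Dp; rewrite (@lowest_le fst) //=.
suff : p.1 - m%:Z + 1 <= leftmost D by clear; lia.
by apply: (@lowest_ge fst) => q Dq; move: (hD _ _ Dp Dq); clear; lia.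
Qed.

Lemma fits_bottommost D l m : fits_rotated D l m ->
  (tree_root D).2 - l%:Z <= bottommost D <= (tree_root D).2.
Proof.
move=> [wD _]; rewrite (@lowest_le snd) ?root_node // andbT.
by apply: (@lowest_ge snd) => q /wD /andP[].
Qed.

(** * Extents under the two constructions *)

(** Each side tree adds at most [m] columns beyond those of [a]. Around the row of [r], the side
    trees reach [l] rows up and down, and [a] reaches [ma] rows down. *)
Lemma fits_construction1 r a b c la ma l m :
  fits a la ma -> fits_rotated b l m -> fits_rotated c l m ->
  construction1 r a b c -> fits (Node r a b c) (la + m) (l + maxn ma l).+1.
Proof.
move=> fa fb fc [[ta ra] [eb rb] [ec rc]].
have lea : r.1 - la%:Z <= leftmost a.
  by apply: (@lowest_ge fst) => p; rewrite -ra; case: fa => wa _ /wa /andP[].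
have rea : rightmost a <= r.1 + la%:Z.
  by apply: (@highest_le fst) => p; rewrite -ra; case: fa => wa _ /wa /andP[].
(* This keeps [b] strictly left and [c] strictly right of the column of [r]. *)
have ler : leftmost a <= r.1 <= rightmost a.
  by rewrite -ra (@lowest_le fst) ?(@highest_ge fst) ?root_node.
have box (p : gridpoint) : p \in nodes (Node r a b c) ->
    (r.1 - (la + m)%:Z <= p.1 <= r.1 + (la + m)%:Z) &&
    (r.2 - (maxn ma l)%:Z <= p.2 <= r.2 + l%:Z).
  rewrite inE !mem_cat => /or4P[/eqP->|Dp|Dp|Dp]; first by clear; lia.
  - move: (fits_topmost fa Dp) ta ra; case: fa => /(_ p Dp) + _; clear; lia.
  - move: (fits_rightmost fb Dp) eb rb lea ler; case: fb => /(_ p Dp) + _; clear; lia.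
  - move: (fits_leftmost fc Dp) ec rc rea ler; case: fc => /(_ p Dp) + _; clear; lia.
by split=> [p /box|p q /box + /box]; rewrite /=; clear; lia.
Qed.

(** The side trees take up to [l] rows above and below the row of [r], and [a] takes at most [ma]
    rows below them. Horizontally [a] lies under the side trees, so only the maximum counts. *)
Lemma fits_construction2 r a b c la ma l m :
  fits a la ma -> fits_rotated b l m -> fits_rotated c l m ->
  construction2 r a b c -> fits (Node r a b c) (maxn la m) (l.*2 + ma).+1.
Proof.
move=> fa fb fc [[eb rb] [ec rc] [ta ra]].
have ba := fits_bottommost fb; have ca := fits_bottommost fc.
have box (p : gridpoint) : p \in nodes (Node r a b c) ->
    (r.1 - (maxn la m)%:Z <= p.1 <= r.1 + (maxn la m)%:Z) &&
    (r.2 - (l + ma)%:Z <= p.2 <= r.2 + l%:Z).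
  rewrite inE !mem_cat => /or4P[/eqP->|Dp|Dp|Dp]; first by clear; lia.
  - move: (fits_topmost fa Dp) ta ra ba ca rb rc.
    by case: fa => /(_ p Dp) + _; clear; lia.
  - move: (fits_rightmost fb Dp) eb rb; case: fb => /(_ p Dp) + _; clear; lia.
  - move: (fits_leftmost fc Dp) ec rc; case: fc => /(_ p Dp) + _; clear; lia.
by split=> [p /box|p q /box + /box]; rewrite /=; clear; lia.
Qed.

(** * Existence of placements *)

Lemma rightmost_translate v D : rightmost (translate v D) = rightmost D + v.1.
Proof. exact: (@highest_map fst). Qed.

Lemma leftmost_translate v D : leftmost (translate v D) = leftmost D + v.1.
Proof. exact: (@lowest_map fst). Qed.

Lemma topmost_translate v D : topmost (translate v D) = topmost D + v.2.
Proof. exact: (@highest_map snd). Qed.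

Lemma bottommost_translate v D : bottommost (translate v D) = bottommost D + v.2.
Proof. exact: (@lowest_map snd). Qed.

Definition translateE := (tree_root_map, rightmost_translate, leftmost_translate,
  topmost_translate, bottommost_translate).

Lemma exists_construction1 (a b c : drawing) : exists u v w,
  construction1 (0, 0) (translate u a) (translate v b) (translate w c).
Proof.
exists (- (tree_root a).1, - 1 - topmost a).
(* After the first translation the leftmost column of [a] is [leftmost a - (tree_root a).1]. *)
exists (leftmost a - (tree_root a).1 - 1 - rightmost b, - (tree_root b).2).
exists (rightmost a - (tree_root a).1 + 1 - leftmost c, - (tree_root c).2).
by split; rewrite !translateE /=; split; lia.
Qed.

Lemma exists_construction2 (a b c : drawing) : exists u v w,
  construction2 (0, 0) (translate u a) (translate v b) (translate w c).
Proof.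
exists (- (tree_root a).1, Num.min (bottommost b - (tree_root b).2)
  (bottommost c - (tree_root c).2) - 1 - topmost a).
exists (- 1 - rightmost b, - (tree_root b).2).
exists (1 - leftmost c, - (tree_root c).2).
by split; rewrite !translateE /=; split; lia.
Qed.

(** * The flat and narrow families *)

Lemma one_two_node1 h a la ma b l m :
  one_two_drawing h a -> one_two_drawing h b -> fits a la ma -> fits b l m ->
  exists2 D, one_two_drawing h.+1 D & fits D (la + m) (l + maxn ma l).+1.
Proof.
move=> Ta Tb fa fb.
have [u [v [w C]]] := exists_construction1 a (rotate_cw b) (rotate_ccw b).
exists (Node (0, 0) (translate u a) (translate v (rotate_cw b))
  (translate w (rotate_ccw b))); first exact: one_two_construction1.
apply: fits_construction1 C; first exact: fits_translate.
  exact: fits_rotate_cw.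
exact: fits_rotate_ccw.
Qed.

Lemma one_two_node2 h a la ma b l m :
  one_two_drawing h a -> one_two_drawing h b -> fits a la ma -> fits b l m ->
  exists2 D, one_two_drawing h.+1 D & fits D (maxn la m) (l.*2 + ma).+1.
Proof.
move=> Ta Tb fa fb.
have [u [v [w C]]] := exists_construction2 a (rotate_cw b) (rotate_ccw b).
exists (Node (0, 0) (translate u a) (translate v (rotate_cw b))
  (translate w (rotate_ccw b))); first exact: one_two_construction2.
apply: fits_construction2 C; first exact: fits_translate.
  exact: fits_rotate_cw.
exact: fits_rotate_ccw.
Qed.

(* The bound on [y] gains a factor [phi] and the one on [k] a factor [s]: these
   are the eigenvector weights that make the induction close. *)
Lemma one_two_pair (R : realFieldType) (phi s : R) (h : nat) :
  0 < phi <= 2 -> phi ^+ 2 = phi + 1 -> 0 < s <= 2 -> s ^+ 2 = 2 ->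
  exists X Y x m y k,
    [/\ one_two_drawing h.+1 X /\ fits X x m, one_two_drawing h.+1 Y /\ fits Y y k,
        [/\ (y <= m)%N, (m.+1)%:R <= 2 * phi ^+ h & phi * (y.+1)%:R <= 2 * phi ^+ h]
      & (x.*2.+1)%:R <= 2 * (1 + s) ^+ h /\ s * k%:R <= 2 * (1 + s) ^+ h].
Proof.
move=> /andP[phi0 phi2] phiE /andP[s0 s2] sE.
elim: h => [|h [X [Y [x [m [y [k [[TX fX] [TY fY] [ym hm hy] [hx hk]]]]]]]]].
  (* The base case, with one node for both drawings, uses [phi <= 2] and [s <= 2]. *)
  have fL : fits (Leaf (0, 0)) 0 1.
    by split=> [p|p q]; rewrite !inE => /eqP-> //; move=> /eqP->.
  exists (Leaf (0, 0)), (Leaf (0, 0)), 0%N, 1%N, 0%N, 1%N.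
  split; try (by split=> //; constructor).
    by split=> //; rewrite expr0; lra.
  by rewrite double0 expr0; split; lra.
have [X' TX' fX'] := one_two_node1 TX TY fX fY.
have [Y' TY' fY'] := one_two_node2 TY TX fY fX.
exists X', Y', (x + k)%N, (y + maxn m y).+1, (maxn y m), (x.*2 + k).+1.
split=> //; rewrite ?exprS; set P := phi ^+ h in hm hy *; set M := (1 + s) ^+ h in hx hk *.
(* The invariant [y <= m] resolves both maxima. Counting [m + 1] and [y + 1] absorbs the additive
   constant of the recurrence. *)
- have -> : maxn y m = m by lia.
  have -> : maxn m y = m by lia.
  split; first by lia.
    have -> : ((y + m).+2)%:R = (y.+1)%:R + (m.+1)%:R :> R by rewrite -natrD; congr _%:R; lia.
    (* Multiplied by [phi], the sum is at most [2 * P + 2 * phi * P = 2 * P * phi ^+ 2]. *)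
    rewrite -(ler_pM2l phi0).
    have : phi * (m.+1)%:R <= phi * (2 * P) by rewrite ler_pM2l.
    have -> : phi * (2 * (phi * P)) = 2 * P * phi ^+ 2 by ring.
    rewrite phiE; lra.
  by rewrite mulrCA ler_pM2l.
(* Writing 2 as [s ^+ 2] lets the bound on [s * k] apply. *)
- have -> : ((x + k).*2.+1)%:R = (x.*2.+1)%:R + k%:R * s ^+ 2 :> R.
    by rewrite sE -natrM -natrD; congr _%:R; lia.
  have hks : s * (s * k%:R) <= s * (2 * M) by rewrite ler_pM2l.
  have hxs : s * (x.*2.+1)%:R <= s * (2 * M) by rewrite ler_pM2l.
  split; first by lra.
  have -> : ((x.*2 + k).+1)%:R = (x.*2.+1)%:R + k%:R :> R.
    by rewrite -natrD; congr _%:R; lia.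
  by lra.
Qed.

(** * From exponential growth to powers of the number of nodes *)

Lemma powR_log (R : realType) (b q : R) k :
  1 < b -> 0 < q -> q ^+ k = (b ^+ k) `^ (ln q / ln b).
Proof.
move=> b1 q0; have b0 : 0 < b by lra.
rewrite -!powR_mulrn ?ltW // -powRrM mulrC powRrM; congr (_ `^ _).
rewrite /powR gt_eqF // divfK ?lnK // gt_eqF // ln_gt0 //.
Qed.

(** The tree of height [h + 1] has at least [3 ^ h] nodes, and [q ^+ h] is [3 ^ h] raised to
    [log_3 q], which is nonnegative. *)
Lemma expr_le_ternary_size (R : realType) (q : R) h : 1 <= q ->
  q ^+ h <= (ternary_size h.+1)%:R `^ (ln q / ln 3).
Proof.
move=> q1; rewrite (@powR_log _ 3) //; [|lra|lra].
apply: ge0_ler_powR; rewrite ?nnegrE ?exprn_ge0 //.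
  by rewrite divr_ge0 ?ln_ge0 //; lra.
rewrite -natrX ler_nat /ternary_size expnS.
have : (0 < 3 ^ h)%N by rewrite expn_gt0.
by move: (3 ^ h)%N => t; lia.
Qed.

(** * Rational bounds on the exponents *)

Lemma ln_ratio_le (R : realType) (q b : R) (i j : nat) :
  0 < q -> 1 < b -> q ^+ j.+1 <= b ^+ i -> ln q / ln b <= i%:R / j.+1%:R.
Proof.
move=> q0 b1 le_qb; have b0 : 0 < b by lra.
have lb0 : 0 < ln b by rewrite ln_gt0.
rewrite ler_pdivrMr // mulrAC ler_pdivlMr ?ltr0n // mulr_natr mulr_natl.
by rewrite -!lnXn // ler_ln ?posrE ?exprn_gt0.
Qed.

(** The coefficients are consecutive Fibonacci numbers for [a = 1] and Pell numbers for [a = 2].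
    High powers become linear in [q], so a rational bound on [q] suffices to estimate them. *)
Lemma expr_quadratic (R : comRingType) (q a : R) n :
  let p := iter n (fun p => (a * p.1 + p.2, p.1)) (1, 0) in
  q ^+ 2 = a * q + 1 -> q ^+ n.+1 = p.1 * q + p.2.
Proof.
move=> p qE; rewrite {}/p; elim: n => [|n IHn] /=; first by rewrite mul1r addr0.
by rewrite exprS IHn mulrDr mulrCA -expr2 qE; ring.
Qed.

Lemma golden_exponent (R : realType) :
  ln ((1 + Num.sqrt 5) / 2) / ln 3 <= 439 / 1000 :> R.
Proof.
set s : R := Num.sqrt 5; set q := (1 + s) / 2.
have sE : s ^+ 2 = 5 by rewrite sqr_sqrtr.
have s0 : 0 <= s by rewrite sqrtr_ge0.
have qE : q ^+ 2 = 1 * q + 1 by rewrite /q; lra.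
have q0 : 0 < q by rewrite /q; lra.
(* A ratio of consecutive Fibonacci numbers, just above the golden ratio. *)
have qle : q <= 34 / 21.
  have : s <= 47 / 21 by nra.
  by rewrite /q; lra.
(* [q ^+ 57 <= 3 ^+ 25] and [25 / 57 <= 0.439]; splitting [57 = 3 * 7 + 4 * 9],
   [25 = 3 * 3 + 4 * 4] keeps the numerals small. *)
have q7 : (q ^+ 7) ^+ 3 <= (14 / 13 * 3 ^+ 3) ^+ 3.
  by rewrite lerXn2r ?nnegrE ?exprn_ge0 ?ltW // (expr_quadratic 6 qE) /=; lra.
have q9 : (q ^+ 9) ^+ 4 <= (47 / 50 * 3 ^+ 4) ^+ 4.
  by rewrite lerXn2r ?nnegrE ?exprn_ge0 ?ltW // (expr_quadratic 8 qE) /=; lra.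
apply: le_trans (@ln_ratio_le _ q 3 25 56 q0 _ _) _; [lra| |lra].
have -> : q ^+ 57 = (q ^+ 7) ^+ 3 * (q ^+ 9) ^+ 4 by rewrite -!exprM -exprD.
(* The remaining factor [(14 / 13) ^ 3 * (47 / 50) ^ 4] is below 1. *)
by apply: le_trans (ler_pM _ _ q7 q9) _; rewrite ?exprn_ge0 ?ltW //; lra.
Qed.

Lemma silver_exponent (R : realType) :
  ln (1 + Num.sqrt 2) / ln 3 <= 803 / 1000 :> R.
Proof.
set s : R := Num.sqrt 2; set q := 1 + s.
have sE : s ^+ 2 = 2 by rewrite sqr_sqrtr.
have s0 : 0 <= s by rewrite sqrtr_ge0.
have qE : q ^+ 2 = 2 * q + 1 by rewrite /q; lra.
have q0 : 0 < q by rewrite /q; lra.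
(* A ratio of consecutive Pell numbers, just above the silver ratio. *)
have qle : q <= 169 / 70.
  have : s <= 99 / 70 by nra.
  by rewrite /q; lra.
(* [q ^+ 71 <= 3 ^+ 57] and [57 / 71 <= 0.803], with [71 = 13 * 5 + 6] and
   [57 = 13 * 4 + 5]. *)
have q5 : (q ^+ 5) ^+ 13 <= (77 / 76 * 3 ^+ 4) ^+ 13.
  by rewrite lerXn2r ?nnegrE ?exprn_ge0 ?ltW // (expr_quadratic 4 qE) /=; lra.
have q6 : q ^+ 6 <= 22 / 27 * 3 ^+ 5.
  by rewrite (expr_quadratic 5 qE) /=; lra.
apply: le_trans (@ln_ratio_le _ q 3 57 70 q0 _ _) _; [lra| |lra].
have -> : q ^+ 71 = (q ^+ 5) ^+ 13 * q ^+ 6 by rewrite -exprM -exprD.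
(* The remaining factor [(77 / 76) ^ 13 * (22 / 27)] is below 1. *)
by apply: le_trans (ler_pM _ _ q5 q6) _; rewrite ?exprn_ge0 ?ltW //; lra.
Qed.

(** * Asymptotic bounds *)

Lemma eqO_nat (R : realType) (f g : nat -> R) (k : R) :
  (forall i, (0 < i)%N -> `|f i| <= k * `|g i|) -> f =O_\oo g.
Proof.
(* The maximum with 1 makes the constant positive. *)
move=> fg; apply/eqO_exP; exists (Num.max 1 k); first by rewrite lt_max ltr01.
near=> i; apply: le_trans (fg i _) _; first by near: i; exact: nbhs_infty_gt.
by rewrite ler_wpM2r // le_max lexx orbT.
Unshelve. all: by end_near. Qed.

Lemma eqO_powR_le (R : realType) (a b : R) (f : nat -> R) : a <= b ->
  f =O_\oo (fun m : nat => m%:R `^ a) -> f =O_\oo (fun m : nat => m%:R `^ b).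
Proof.
move=> ab fa; apply: eqO_trans fa _; apply: (@eqO_nat _ _ _ 1) => i i0.
by rewrite mul1r !ger0_norm ?powR_ge0 // ler_powR // ler1n.
Qed.

Theorem theorem2 (R : realType) :
  let n (h : nat) : R := (ternary_size h)%:R in
  let alpha : R := ln ((1 + Num.sqrt 5) / 2) / ln 3 in
  let beta : R := ln (1 + Num.sqrt 2) / ln 3 in
  (exists D : nat -> drawing,
    [/\ forall h : nat, (0 < h)%N -> one_two_drawing h (D h),
        (fun h : nat => (height (D h))%:R : R) =O_\oo (fun h : nat => n h `^ alpha),
        (fun h : nat => (width (D h))%:R : R) =O_\oo (fun h : nat => n h `^ beta)
      & (fun h : nat => (area (D h))%:R : R) =O_\oo (fun h : nat => n h `^ (1242 / 1000))]) /\
  (forall f : nat -> R,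
    f =O_\oo (fun m : nat => m%:R `^ alpha) ->
    f =O_\oo (fun m : nat => m%:R `^ (439 / 1000))) /\
  (forall f : nat -> R,
    f =O_\oo (fun m : nat => m%:R `^ beta) ->
    f =O_\oo (fun m : nat => m%:R `^ (803 / 1000))).
Proof.
move=> n; set phi : R := (1 + Num.sqrt 5) / 2; set s : R := Num.sqrt 2.
move=> alpha beta.
have ha : alpha <= 439 / 1000 by exact: golden_exponent.
have hb : beta <= 803 / 1000 by exact: silver_exponent.
split; last by split=> f; apply: eqO_powR_le.
have s5 : 1 <= Num.sqrt 5 :> R by rewrite -[leLHS]sqrtr1 ler_wsqrtr //; lra.
have s2 : 1 <= s by rewrite -[leLHS]sqrtr1 ler_wsqrtr //; lra.
have drawings h : exists D, [/\ one_two_drawing h.+1 D,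
    (height D)%:R <= 2 * n h.+1 `^ alpha & (width D)%:R <= 2 * n h.+1 `^ beta].
  have s5E : Num.sqrt 5 ^+ 2 = 5 :> R by rewrite sqr_sqrtr.
  have s2E : s ^+ 2 = 2 by rewrite sqr_sqrtr.
  have phi_bnd : 0 < phi <= 2 by apply/andP; split; rewrite /phi; nra.
  have phi1 : 1 <= phi by rewrite /phi; lra.
  have phiE : phi ^+ 2 = phi + 1 by rewrite /phi; lra.
  have s2_bnd : 0 < s <= 2 by apply/andP; split; nra.
  have [X [_ [x [m [_ [_ [[TX fX] _ [_ hm _] [hx _]]]]]]]] :=
    one_two_pair h phi_bnd phiE s2_bnd s2E.
  exists X; split=> //.
    apply: le_trans (_ : (m.+1)%:R <= _).
      by rewrite ler_nat leqW // (fits_height fX).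
    by apply: le_trans hm _; rewrite ler_pM2l // expr_le_ternary_size.
  apply: le_trans (_ : (x.*2.+1)%:R <= _); first by rewrite ler_nat (fits_width fX).
  by apply: le_trans hx _; rewrite ler_pM2l // expr_le_ternary_size //; lra.
have [D DP] := choice drawings.
(* [D h] draws the tree of height [h + 1], hence the shift; the value at height 0 is arbitrary. *)
exists (fun h => D h.-1); split.
- by move=> [|h] //= _; have [] := DP h.
- apply: (@eqO_nat _ _ _ 2) => -[|h] //= _.
  by rewrite !ger0_norm ?powR_ge0 //; have [] := DP h.
- apply: (@eqO_nat _ _ _ 2) => -[|h] //= _.
  by rewrite !ger0_norm ?powR_ge0 //; have [] := DP h.
(* The same drawing meets both bounds, so the area is at most [2 * 2] times the power with exponent
   [alpha + beta <= 0.439 + 0.803 = 1.242]. *)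
apply: (@eqO_nat _ _ _ 4) => -[|h] //= _; rewrite !ger0_norm ?powR_ge0 // /area natrM.
have [_ hH hW] := DP h.
have n1 : 1 <= n h.+1.
  rewrite ler1n /ternary_size expnS.
  have : (0 < 3 ^ h)%N by rewrite expn_gt0.
  by move: (3 ^ h)%N => t; lia.
apply: le_trans (ler_pM _ _ hW hH) _ => //.
rewrite mulrACA -natrM ler_pM2l // -powRD; last first.
  by apply/implyP => _; rewrite gt_eqF // (lt_le_trans _ n1).
by rewrite ler_powR //; lra.
Qed.
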